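(* Let $X$ be a Banach lattice of nontrivial type and let $p\in(1,\infty)$. Then $\sup_{n\in\mathbb N}\mathfrak P_p^n(X)<\infty$.
   Context: A Banach space $X$ has Rademacher type $r\in[1,2]$ if there exists $T\in(0,\infty)$ such that for all $n\in\mathbb N$ and all $x_1,\ldots,x_n\in X$, $\int_{\{-1,1\}^n}\|\sum_{j=1}^n\varepsilon_jx_j\|^rd\mu(\varepsilon)\le T^r\sum_{j=1}^n\|x_j\|^r$, where $\mu$ is the uniform probability measure on $\{-1,1\}^n$; $X$ has nontrivial type if it has Rademacher type $r$ for some $r>1$. For $f:\{-1,1\}^n\to X$ and $j\in\{1,\ldots,n\}$, $\partial_jf(\varepsilon)=\frac{f(\varepsilon)-f(\varepsilon_1,\ldots,\varepsilon_{j-1},-\varepsilon_j,\varepsilon_{j+1},\ldots,\varepsilon_n)}{2}$ and $\Delta f=\sum_{j=1}^n\partial_jf$. $\mathfrak P_p^n(X)$ is the infimum over those $\mathfrak P\in(0,\infty)$ such that every $f_1,\ldots,f_n:\{-1,1\}^n\to X$ satisfy $$\Bigg(\int_{\{-1,1\}^n}\Big\|\sum_{j=1}^n\partial_jf_j(\varepsilon)\Big\|^pd\mu(\varepsilon)\Bigg)^{1/p}\le\mathfrak P\Bigg(\int_{\{-1,1\}^n}\int_{\{-1,1\}^n}\Big\|\sum_{j=1}^n\delta_j\Delta f_j(\varepsilon)\Big\|^pd\mu(\varepsilon)d\mu(\delta)\Bigg)^{1/p}.$$ *)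

(* Defs.v *)
From HB Require Import structures.
From mathcomp Require Import all_boot all_order all_algebra.
From mathcomp Require Import all_classical all_reals all_analysis.
Import Order.TTheory GRing.Theory Num.Theory.
Import numFieldNormedType.Exports.

Set Implicit Arguments.
Unset Strict Implicit.
Unset Printing Implicit Defensive.

Local Open Scope classical_set_scope.
Local Open Scope ring_scope.

(* The order is carried by dedicated operations because HB rejects a direct join
   of CompleteNormedModule with Order.Lattice (intermediate joins shared with
   Num.RealDomain are missing). The library's lattice structure is recovered
   below on the alias [lattice_of X]. *)
HB.mixin Record isBanachLattice (R : realType) (X : Type)
    of CompleteNormedModule R X := {
  bl_le : rel X;
  bl_meet : X -> X -> X;
  bl_join : X -> X -> X;
  bl_le_refl : reflexive bl_le;
  bl_le_anti : antisymmetric bl_le;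
  bl_le_trans : transitive bl_le;
  bl_meetP : forall x y z : X, bl_le x (bl_meet y z) = bl_le x y && bl_le x z;
  bl_joinP : forall x y z : X, bl_le (bl_join x y) z = bl_le x z && bl_le y z;
  bl_leD2r : forall x y z : X, bl_le x y -> bl_le (x + z) (y + z);
  bl_scale_ge0 : forall (a : R) (x : X), 0 <= a -> bl_le 0 x -> bl_le 0 (a *: x);
  (* bl_join x (- x) is the modulus |x| of x *)
  bl_le_norm : forall x y : X,
    bl_le (bl_join x (- x)) (bl_join y (- y)) -> `|x| <= `|y|
}.

#[short(type="banachLatticeType")]
HB.structure Definition BanachLattice (R : realType) :=
  {X of isBanachLattice R X & CompleteNormedModule R X}.

Definition lattice_of (R : realType) (X : banachLatticeType R) : Type := X.

Section LatticeOf.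
Context (R : realType) (X : banachLatticeType R).

HB.instance Definition _ := Choice.on (lattice_of X).

HB.instance Definition _ := Order.Le_isPOrder.Build ring_display (lattice_of X)
  (@bl_le_refl R X) (@bl_le_anti R X) (@bl_le_trans R X).

HB.instance Definition _ :=
  Order.POrder_MeetJoin_isLattice.Build ring_display (lattice_of X)
    (@bl_meetP R X) (@bl_joinP R X).

End LatticeOf.

(* The discrete cube {-1,1}^n: a vertex is a Boolean vector, whose i-th
   coordinate is the sign (-1)^(e i). *)
Definition cube (n : nat) := {ffun 'I_n -> bool}.

Definition sgn (R : realType) (n : nat) (e : cube n) (i : 'I_n) : R :=
  (-1) ^+ (e i).

Definition flip (n : nat) (j : 'I_n) (e : cube n) : cube n :=
  [ffun i => if i == j then ~~ e i else e i].

(* Integral against the uniform probability measure on the cube. *)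
Definition cube_avg (R : realType) (n : nat) (F : cube n -> R) : R :=
  (2 ^+ n)^-1 * \sum_(e : cube n) F e.

Section NormedSpace.
Context (R : realType) (X : completeNormedModType R).

Definition rademacher_type (r : R) : Prop :=
  1 <= r <= 2 /\
  exists T : R, 0 < T /\
    forall (n : nat) (x : 'I_n -> X),
      cube_avg (fun e : cube n => `|\sum_(j < n) sgn R e j *: x j| `^ r)
      <= T `^ r * \sum_(j < n) `|x j| `^ r.

Definition nontrivial_type : Prop :=
  exists r : R, 1 < r /\ rademacher_type r.

Definition cube_partial (n : nat) (j : 'I_n) (f : cube n -> X) (e : cube n) : X :=
  2^-1 *: (f e - f (flip j e)).

Definition cube_laplacian (n : nat) (f : cube n -> X) (e : cube n) : X :=
  \sum_(j < n) cube_partial j f e.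

Definition pisier_bound (p : R) (n : nat) (P : R) : Prop :=
  forall f : 'I_n -> cube n -> X,
    (cube_avg (fun e : cube n =>
       `|\sum_(j < n) cube_partial j (f j) e| `^ p)) `^ p^-1
    <= P *
    (cube_avg (fun d : cube n => cube_avg (fun e : cube n =>
       `|\sum_(j < n) sgn R d j *: cube_laplacian (f j) e| `^ p))) `^ p^-1.

(* Extended-real valued, so that the infimum of the empty set is +oo. *)
Definition pisier_const (p : R) (n : nat) : \bar R :=
  ereal_inf [set P%:E | P in [set P : R | 0 < P /\ pisier_bound p n P]].

End NormedSpace.

(* Main.v *)
(** The kernel of the noise operator of correlation rho is the product kernel
    [\prod_j (1 + rho xi_j) / 2], so [\sum_j \partial_j f_j] is the integral over
    rho in [0, 1] of the functions
      [G_rho (e) = E_xi \sum_j kappa (xi_j) (Delta f_j) (e xi)],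
    where the xi_j are independent of mean rho and
    [kappa (xi) = xi / (1 + rho xi)] has mean zero. Jensen's inequality and the
    change of variables e -> e xi decouple xi from e; symmetrizing kappa turns
    the sum into a Rademacher sum over a random set of indices, each one selected
    with probability s = (1 - rho^2) / 2, times the factor 2 / (1 - rho^2).

    It remains to gain a factor s^gamma, gamma > 0, over the full Rademacher sum,
    which makes the bound integrable at rho = 1. Selections compose, so a gain
    c < 1 for the single value s = 2^-k is enough. Splitting the indices at random
    into 2^k classes reduces this to: 2^k vectors cannot have signed sums
    as small as the vectors themselves, since l_infty^(2^k) contains l_1^k, and
    nontrivial type excludes l_1^k for large k.
    The integral over rho is replaced by Riemann sums with m^N steps, m = 2^k. *)

Require Import Defs.
From mathcomp Require Import all_boot all_order all_algebra.
From mathcomp Require Import all_classical all_reals all_analysis.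
From mathcomp Require Import ring lra.
Import Order.TTheory GRing.Theory Num.Theory.
Import numFieldNormedType.Exports.
Set Implicit Arguments.
Unset Strict Implicit.
Unset Printing Implicit Defensive.
Local Open Scope classical_set_scope.
Local Open Scope ring_scope.

(** * Tangent and Jensen inequalities for real powers *)

Section PowerMeans.
Context (R : realType).
Implicit Types (p a x : R).

(** Young's inequality for [x] and [a ^ (p - 1)]; at [p = 1] the conjugate exponent degenerates. *)
Lemma powR_tangent p a x : 1 <= p -> 0 <= a -> 0 <= x ->
  a `^ p + p * a `^ (p - 1) * (x - a) <= x `^ p.
Proof.
move=> p1 a0 x0.
have p0 : 0 < p by apply: lt_le_trans p1.
have e1 : a `^ (p - 1) * a = a `^ p by rewrite mulrC mulr_powRB1.
rewrite mulrBr -(mulrA p _ a) e1.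
suff : p * (x * a `^ (p - 1)) <= x `^ p + (p - 1) * a `^ p by lra.
have [->|pn1] := eqVneq p 1.
  by rewrite subrr powRr0 powRr1 //; lra.
have p1' : 0 < p - 1 by rewrite subr_gt0 lt_neqAle eq_sym pn1.
have q0 : 0 < p / (p - 1) by rewrite divr_gt0.
have pq : p^-1 + (p / (p - 1))^-1 = 1.
  by field; rewrite ?gt_eqF.
have := conjugate_powR x0 (powR_ge0 a (p - 1)) p0 q0 pq.
rewrite -powRrM mulrCA divff ?gt_eqF// mulr1 => /(ler_wpM2l (ltW p0)).
congr (_ <= _); field; rewrite ?gt_eqF//.
Qed.

(** Average the tangent inequality at the mean [m]: the linear terms cancel. *)
Lemma powR_jensen (I : finType) (u a : I -> R) p : 1 <= p ->
  (forall i, 0 <= u i) -> \sum_i u i = 1 -> (forall i, 0 <= a i) ->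
  (\sum_i u i * a i) `^ p <= \sum_i u i * a i `^ p.
Proof.
move=> p1 u0 u1 a0; set m := \sum_i _.
have m0 : 0 <= m by apply: sumr_ge0 => i _; rewrite mulr_ge0.
have -> : m `^ p = \sum_i u i * (m `^ p + p * m `^ (p - 1) * (a i - m)).
  under eq_bigr => i _ do rewrite mulrDr mulrBr mulrBr [u i * (_ * a i)]mulrCA.
  rewrite big_split/= -mulr_suml u1 sumrB/= -mulr_sumr -mulr_suml u1 -/m.
  by rewrite mul1r mul1r subrr addr0.
by apply: ler_sum => i _; rewrite ler_wpM2l// powR_tangent.
Qed.

Lemma le_powR p a x : 0 <= p -> 0 <= a -> a <= x -> a `^ p <= x `^ p.
Proof.
by move=> p0 a0 ax; apply: ge0_ler_powR => //; rewrite nnegrE ?(le_trans a0).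
Qed.

Lemma powRrMK p x : p != 0 -> 0 <= x -> (x `^ p^-1) `^ p = x.
Proof. by move=> p0 x0; rewrite -powRrM mulVf// powRr1. Qed.

Lemma powRrKM p x : p != 0 -> 0 <= x -> (x `^ p) `^ p^-1 = x.
Proof. by move=> p0 x0; rewrite -powRrM mulfV// powRr1. Qed.

Lemma powR_divK p q x : 0 < p -> 0 < q -> 0 <= x ->
  (x `^ (p / q)) `^ (q / p) = x.
Proof.
move=> p0 q0 x0; rewrite -powRrM -[in RHS](powRr1 x0); congr (_ `^ _).
by field; rewrite !gt_eqF.
Qed.

End PowerMeans.

(** * Jensen's inequality for powers of norms *)

Section NormJensen.
Context (R : realType) (X : normedModType R).

Lemma norm_jensen (I : finType) (u : I -> R) (x : I -> X) (p : R) : 1 <= p ->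
  (forall i, 0 <= u i) -> \sum_i u i = 1 ->
  `|\sum_i u i *: x i| `^ p <= \sum_i u i * `|x i| `^ p.
Proof.
move=> p1 u0 u1.
apply: le_trans (powR_jensen p1 u0 u1 (fun i => normr_ge0 (x i))).
apply: le_powR => //; first exact: le_trans p1.
apply: le_trans (ler_norm_sum _ _ _) _.
by apply: ler_sum => i _; rewrite normrZ ger0_norm.
Qed.

End NormJensen.

(** * Expectations under product laws *)

Section ProductExpectation.
Context (R : realType) (J : finType).

Definition iid_avg (A : finType) (u : A -> R) (G : {ffun J -> A} -> R) : R :=
  \sum_(a : {ffun J -> A}) (\prod_j u (a j)) * G a.

Lemma iid_weight_ge0 (A : finType) (u : A -> R) (a : {ffun J -> A}) :
  (forall i, 0 <= u i) -> 0 <= \prod_j u (a j).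
Proof. by move=> u0; apply: prodr_ge0. Qed.

Lemma iid_weight_sum (A : finType) (u : A -> R) :
  \sum_i u i = 1 -> \sum_(a : {ffun J -> A}) \prod_j u (a j) = 1.
Proof.
move=> u1; rewrite -(bigA_distr_bigA (fun _ => u)) big1// => j _; exact: u1.
Qed.

Lemma iid_avg_cst (A : finType) (u : A -> R) c :
  \sum_i u i = 1 -> iid_avg u (fun=> c) = c.
Proof. by move=> u1; rewrite /iid_avg -mulr_suml iid_weight_sum// mul1r. Qed.

Lemma iid_avg_le (A : finType) (u : A -> R) (G H : {ffun J -> A} -> R) :
  (forall i, 0 <= u i) -> (forall a, G a <= H a) -> iid_avg u G <= iid_avg u H.
Proof.
by move=> u0 GH; apply: ler_sum => a _; rewrite ler_wpM2l// iid_weight_ge0.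
Qed.

Lemma iid_avgZ (A : finType) (u : A -> R) (G : {ffun J -> A} -> R) c :
  iid_avg u (fun a => c * G a) = c * iid_avg u G.
Proof.
by rewrite /iid_avg mulr_sumr; apply: eq_bigr => a _; rewrite mulrCA.
Qed.

Lemma iid_avg_sum (A I : finType) (u : A -> R) (G : I -> {ffun J -> A} -> R) :
  iid_avg u (fun a => \sum_i G i a) = \sum_i iid_avg u (G i).
Proof.
rewrite /iid_avg exchange_big/=; apply: eq_bigr => a _; exact: mulr_sumr.
Qed.

Lemma eq_iid_avg (A : finType) (u v : A -> R) (G H : {ffun J -> A} -> R) :
  u =1 v -> G =1 H -> iid_avg u G = iid_avg v H.
Proof.
move=> uv GH; apply: eq_bigr => a _; rewrite GH; congr (_ * _).
by apply: eq_bigr.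
Qed.

Lemma iid_avg_push (A B : finType) (f : A -> B) (u : A -> R)
    (G : {ffun J -> B} -> R) :
  iid_avg u (fun a => G [ffun j => f (a j)]) =
  iid_avg (fun b => \sum_(i | f i == b) u i) G.
Proof.
rewrite /iid_avg (partition_big (fun a : {ffun J -> A} => [ffun j => f (a j)]) xpredT)//=.
apply: eq_bigr => b _.
rewrite (bigA_distr_big_dep (fun j i => f i == b j) (fun _ => u)) mulr_suml.
apply: eq_big => [a|a /eqP -> //].
apply/eqP/familyP => [<- j|h]; first by rewrite ffunE unfold_in.
by apply/ffunP => j; rewrite ffunE; apply/eqP; exact: h.
Qed.

Lemma iid_avg_pair (A B : finType) (u : A -> R) (v : B -> R)
    (G : {ffun J -> A} -> {ffun J -> B} -> R) :
  iid_avg u (fun a => iid_avg v (G a)) =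
  iid_avg (fun c : A * B => u c.1 * v c.2)
    (fun c => G [ffun j => (c j).1] [ffun j => (c j).2]).
Proof.
rewrite /iid_avg.
under eq_bigr => a _ do rewrite mulr_sumr.
rewrite pair_bigA/=.
pose h (c : {ffun J -> A * B}) := ([ffun j => (c j).1], [ffun j => (c j).2]).
pose k (c : {ffun J -> A} * {ffun J -> B}) := [ffun j => (c.1 j, c.2 j)].
rewrite (reindex h)/=; last first.
  exists k => [c _|[a b] _]; first by apply/ffunP => j; rewrite !ffunE/= -surjective_pairing.
  by congr (_, _); apply/ffunP => j; rewrite !ffunE.
apply: eq_bigr => c _; rewrite mulrA -big_split/=; congr (_ * _).
by apply: eq_bigr => j _; rewrite !ffunE.
Qed.

(** Reduces the comparison of two product expectations to that of the laws of one coordinate. *)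
Lemma iid_avg_push2 (A B C : finType) (f : A -> B -> C) (u : A -> R)
    (v : B -> R) (G : {ffun J -> C} -> R) :
  iid_avg u (fun a => iid_avg v (fun b => G [ffun j => f (a j) (b j)])) =
  iid_avg (fun c => \sum_(i | f i.1 i.2 == c) u i.1 * v i.2) G.
Proof.
rewrite iid_avg_pair -(iid_avg_push (fun i => f i.1 i.2)).
apply: eq_iid_avg => // a; congr G; apply/ffunP => j; by rewrite !ffunE.
Qed.

End ProductExpectation.

Lemma iid_avgC (R : realType) (J J' A B : finType) (u : A -> R) (v : B -> R)
    (G : {ffun J -> A} -> {ffun J' -> B} -> R) :
  iid_avg u (fun a => iid_avg v (G a)) = iid_avg v (fun b => iid_avg u (G ^~ b)).
Proof.
rewrite [RHS]iid_avg_sum; apply: eq_bigr => a _.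
by rewrite iid_avgZ.
Qed.

(** * Rademacher averages and random selections of indices *)

Section RademacherAverages.
Context (R : realType) (X : normedModType R) (p : R).
Hypothesis p1 : 1 <= p.

Definition coin (b : bool) : R := 2^-1.

Lemma coin_ge0 b : 0 <= coin b.
Proof. by rewrite invr_ge0. Qed.

Lemma coin_sum : \sum_b coin b = 1.
Proof. by rewrite big_bool /coin/=; lra. Qed.

Lemma iid_coinE (J : finType) (G : {ffun J -> bool} -> R) :
  iid_avg coin G = (2 ^+ #|J|)^-1 * \sum_e G e.
Proof.
rewrite /iid_avg mulr_sumr; apply: eq_bigr => e _.
by rewrite prodr_const exprVn.
Qed.

Lemma iid_coin_reindex (J : finType) (h : {ffun J -> bool} -> {ffun J -> bool})
    (G : {ffun J -> bool} -> R) : involutive h ->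
  iid_avg coin (fun e => G (h e)) = iid_avg coin G.
Proof.
by move=> hh; rewrite !iid_coinE [in RHS](reindex h)//; exists h => e _.
Qed.

Definition rad (J : finType) (x : J -> X) : R :=
  iid_avg coin (fun e : {ffun J -> bool} => `|\sum_j (-1) ^+ (e j) *: x j| `^ p).

Lemma eq_rad (J : finType) (x y : J -> X) : x =1 y -> rad x = rad y.
Proof.
move=> xy; apply: eq_iid_avg => // e; congr (`|_| `^ p).
by apply: eq_bigr => j _; rewrite xy.
Qed.

Lemma rad_sign (J : finType) (t : J -> bool) (x : J -> X) :
  rad (fun j => (-1) ^+ (t j) *: x j) = rad x.
Proof.
rewrite /rad -[RHS](@iid_coin_reindex J (fun e => [ffun j => e j (+) t j])).
  apply: eq_iid_avg => // e; congr (`|_| `^ p).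
  by apply: eq_bigr => j _; rewrite ffunE signr_addb scalerA.
by move=> e; apply/ffunP => j; rewrite !ffunE -addbA addbb addbF.
Qed.

(* The subsum over [t] is the half sum of the full sum and of the full sum with
   the signs outside [t] reversed; both have the same distribution. *)
Lemma rad_subset (J : finType) (t : J -> bool) (x : J -> X) :
  rad (fun j => (t j)%:R *: x j) <= rad x.
Proof.
have -> : rad x = 2^-1 * rad x + 2^-1 * rad (fun j => (-1) ^+ (~~ t j) *: x j).
  by rewrite rad_sign; lra.
rewrite /rad -!iid_avgZ /iid_avg -big_split/=; apply: ler_sum => e _.
rewrite -mulrDr ler_wpM2l//; first by apply: iid_weight_ge0; exact: coin_ge0.
set a := \sum_j _ *: x j; set b := \sum_j _ *: ((-1) ^+ _ *: x j).
pose y (c : bool) := if c then a else b.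
have := norm_jensen y p1 coin_ge0 coin_sum.
rewrite !big_bool /coin/= => H; apply: le_trans _ H.
rewrite le_eqVlt; apply/orP; left; apply/eqP; congr (`|_| `^ p).
rewrite -scalerDr -big_split/= scaler_sumr; apply: eq_bigr => j _.
rewrite !scalerA -scalerDl scalerA; congr (_ *: _).
case: (t j) => /=; rewrite ?expr0 ?expr1; lra.
Qed.

Lemma rad_coord (J : finType) (x : J -> X) j : `|x j| `^ p <= rad x.
Proof.
apply: le_trans (rad_subset (fun i => i == j) x).
rewrite /rad (_ : iid_avg _ _ = iid_avg (J := J) coin (fun=> `|x j| `^ p)).
  by rewrite iid_avg_cst// coin_sum.
apply: eq_iid_avg => // e; rewrite (bigD1 j)//= big1 ?addr0.
  by rewrite eqxx scale1r normrZ normrX normrN1 expr1n mul1r.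
by move=> i /negbTE ->; rewrite scale0r scaler0.
Qed.

Lemma rad_ge0 (J : finType) (x : J -> X) : 0 <= rad x.
Proof.
apply: sumr_ge0 => e _; rewrite mulr_ge0 ?powR_ge0//.
by apply: iid_weight_ge0; exact: coin_ge0.
Qed.

Definition bern (s : R) (b : bool) : R := if b then s else 1 - s.

Lemma bern_ge0 s b : 0 <= s <= 1 -> 0 <= bern s b.
Proof. by case/andP=> s0 s1; case: b => //=; rewrite subr_ge0. Qed.

Lemma bern_sum s : \sum_b bern s b = 1.
Proof. by rewrite big_bool /=; lra. Qed.

Definition sel (J : finType) (s : R) (x : J -> X) : R :=
  iid_avg (bern s) (fun t : {ffun J -> bool} => rad (fun j => (t j)%:R *: x j)).

Lemma sel_le_rad (J : finType) s (x : J -> X) : 0 <= s <= 1 ->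
  sel s x <= rad x.
Proof.
move=> s01; rewrite -[leRHS](iid_avg_cst J _ (bern_sum s)).
apply: iid_avg_le => [b|t]; [exact: bern_ge0|exact: rad_subset].
Qed.

(** The conjunction of independent bits of parameters [s] and [s'] has parameter [s * s']. *)
Lemma sel_comp (J : finType) s s' (x : J -> X) :
  sel (s * s') x =
  iid_avg (bern s) (fun t : {ffun J -> bool} => sel s' (fun j => (t j)%:R *: x j)).
Proof.
pose G (t : {ffun J -> bool}) := rad (fun j => (t j)%:R *: x j).
transitivity (iid_avg (bern s) (fun t => iid_avg (bern s') (fun t' =>
   G [ffun j => t j && t' j]))).
  rewrite (iid_avg_push2 andb); apply: eq_iid_avg => // c.
  rewrite (big_mkcond (fun i => _ == _)).
  rewrite -(pair_bigA _ (fun i j => if i && j == c then bern s i * bern s' j else 0))/=.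
  rewrite !big_bool/=; case: c => /=; lra.
apply: eq_iid_avg => // t; apply: eq_iid_avg => // t'; apply: eq_rad => j.
by rewrite ffunE scalerA -natrM mulnb andbC.
Qed.

(** Selecting with parameter [s] is selecting with [s * m] and then with [1 / m]; the second
    selection gains [th]. *)
Lemma sel_decay (m : nat) (th : R) (J : finType) : (0 < m)%N -> 0 <= th ->
  (forall x : J -> X, sel m%:R^-1 x <= th * rad x) ->
  forall s (x : J -> X), 0 <= s -> s * m%:R <= 1 -> sel s x <= th * sel (s * m%:R) x.
Proof.
move=> m0 th0 H s x s0 sm.
have m0' : 0 < m%:R :> R by rewrite ltr0n.
have {1}-> : s = (s * m%:R) * m%:R^-1 by rewrite mulfK ?gt_eqF.
rewrite sel_comp /sel -iid_avgZ; apply: iid_avg_le => [b|t]; last exact: H.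
by apply: bern_ge0; rewrite sm andbT mulr_ge0// ltW.
Qed.

(* Colouring the indices uniformly and independently by [K] makes each colour
   class a Bernoulli selection of parameter [1 / #|K|]. *)
Lemma sel_colour (K J : finType) (th : R) : (0 < #|K|)%N ->
  (forall y : K -> X, #|K|%:R^-1 * \sum_i `|y i| `^ p <= th * rad y) ->
  forall x : J -> X, sel #|K|%:R^-1 x <= th * rad x.
Proof.
move=> K0 H x; set m : R := #|K|%:R.
have m0 : 0 < m by rewrite ltr0n.
pose unif (i : K) : R := m^-1.
have unif0 i : 0 <= unif i by rewrite invr_ge0 ltW.
have unif1 : \sum_i unif i = 1.
  by rewrite sumr_const -mulr_natl mulfV ?gt_eqF.
have selE i : sel m^-1 x =
    iid_avg unif (fun c : {ffun J -> K} => rad (fun j => (c j == i)%:R *: x j)).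
  pose G (t : {ffun J -> bool}) := rad (fun j => (t j)%:R *: x j).
  transitivity (iid_avg unif (fun c : {ffun J -> K} => G [ffun j => c j == i])).
    rewrite (iid_avg_push (fun c => c == i)); apply: eq_iid_avg => // b.
    have E1 : \sum_(c | c == i) unif c = m^-1 by rewrite big_pred1_eq.
    case: b => /=.
      by under eq_bigl => c do rewrite eqb_id; rewrite E1.
    under eq_bigl => c do rewrite eqbF_neg.
    by move: unif1; rewrite (bigID (fun c => c == i))/= E1 => <-; rewrite addrC addrK.
  by apply: eq_iid_avg => // c; apply: eq_rad => j; rewrite ffunE.
have -> : sel m^-1 x = m^-1 * \sum_(i : K) sel m^-1 x.
  by rewrite sumr_const -mulr_natl mulrA mulVf ?mul1r ?gt_eqF.
under eq_bigr => i _ do rewrite (selE i).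
rewrite -iid_avg_sum -iid_avgZ -[leRHS](iid_avg_cst J _ unif1).
apply: iid_avg_le => // c.
rewrite -iid_avg_sum -iid_avgZ.
pose y (e : {ffun J -> bool}) i := \sum_j (-1) ^+ (e j) *: ((c j == i)%:R *: x j).
apply: (@le_trans _ _ (iid_avg coin (fun e => th * rad (y e)))).
  by apply: iid_avg_le; [exact: coin_ge0|move=> e; exact: H].
rewrite iid_avgZ le_eqVlt; apply/orP; left; apply/eqP; congr (_ * _).
(* The signs [d] of the colours are absorbed into the signs [e] of the indices, through
   [d (c j)]. *)
rewrite /rad iid_avgC -[RHS](iid_avg_cst K _ coin_sum).
apply: eq_iid_avg => // d; rewrite -[RHS](rad_sign (fun j => d (c j))).
apply: eq_iid_avg => // e; congr (`|_| `^ p); rewrite /y.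
under eq_bigr => i _ do rewrite scaler_sumr.
rewrite exchange_big/=; apply: eq_bigr => j _.
rewrite (bigD1 (c j))//= eqxx scale1r big1 ?addr0 => [|i].
  by rewrite !scalerA mulrC.
by rewrite eq_sym => /negbTE ->; rewrite scale0r !scaler0.
Qed.

End RademacherAverages.

(** * Consequences of nontrivial type *)

Section TypeConsequences.
Context (R : realType) (X : completeNormedModType R) (p : R).
Hypothesis p_gt1 : 1 < p.

Lemma cube_avgE (n : nat) (F : cube n -> R) :
  cube_avg F = iid_avg (@coin R) F.
Proof. by rewrite iid_coinE card_ord. Qed.

(** The triangle inequality alone gives [n ^ p] times the mean of the [p]-th powers of the norms;
    type supplies the remaining factor. *)
Lemma rad_le_of_type (r T : R) (n : nat) (x : 'I_n -> X) :
  (0 < n)%N -> 1 < r -> 0 < T ->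
  rad r x <= T `^ r * \sum_(j < n) `|x j| `^ r ->
  rad p x <= T `^ Num.min p r * n%:R `^ (1 - Num.min p r) *
    (n%:R `^ p * (n%:R^-1 * \sum_j `|x j| `^ p)).
Proof.
move=> n0 r1 T0 typ; set M := n%:R^-1 * _.
have n0' : 0 < n%:R :> R by rewrite ltr0n.
have p0 : 0 < p by apply: lt_trans p_gt1.
have r0 : 0 < r by apply: lt_trans r1.
have u0 (i : 'I_n) : 0 <= n%:R^-1 :> R by rewrite invr_ge0 ltW.
have u1 : \sum_(i < n) n%:R^-1 = 1 :> R.
  by rewrite sumr_const card_ord -[LHS]mulr_natl mulfV ?gt_eqF.
have S0 : 0 <= \sum_j `|x j| `^ p by apply: sumr_ge0 => j _; exact: powR_ge0.
have M0 : 0 <= M by rewrite mulr_ge0// invr_ge0 ltW.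
have MS : \sum_j `|x j| `^ p = n%:R * M by rewrite /M mulVKf ?gt_eqF.
have npow q : n%:R `^ (1 - q) * n%:R `^ p = n%:R `^ (p - q) * n%:R :> R.
  have n0b : n%:R != 0 :> R by rewrite gt_eqF.
  rewrite -powRD ?n0b ?implybT// (_ : 1 - q + p = p - q + 1); last by ring.
  by rewrite powRD ?n0b ?implybT// powRr1 ?ltW.
have [rp|pr] := leP r p.
(* For [r <= p], the [p]-th power of the norm splits into powers [p - r], bounded by the triangle
   inequality, and [r], bounded by type; power means express both through [M]. *)
- rewrite mulrA -(mulrA _ _ (_ `^ p)) npow.
  set A1 := n%:R^-1 * \sum_j `|x j|.
  have A10 : 0 <= A1 by rewrite mulr_ge0 ?invr_ge0 ?(ltW n0')// sumr_ge0.
  have A1M : A1 <= M `^ p^-1.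
    rewrite -[A1](powRrKM (lt0r_neq0 p0))//.
    apply: le_powR; rewrite ?invr_ge0 ?(ltW p0) ?powR_ge0//.
    rewrite /A1 /M !mulr_sumr; exact: (powR_jensen (ltW p_gt1) u0 u1 (fun j => normr_ge0 (x j))).
  have ArM : \sum_j `|x j| `^ r <= n%:R * M `^ (r / p).
    rewrite -ler_pdivrMl//.
    have pr1 : 1 <= p / r by rewrite ler_pdivlMr// mul1r.
    set B := _ * _; have B0 : 0 <= B.
      by rewrite mulr_ge0 ?invr_ge0 ?(ltW n0')// sumr_ge0// => j _; exact: powR_ge0.
    have -> : B = (B `^ (p / r)) `^ (r / p).
      by rewrite powR_divK.
    apply: le_powR; rewrite ?powR_ge0 ?divr_ge0 ?(ltW p0) ?(ltW r0)//.
    rewrite /B /M !mulr_sumr.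
    apply: le_trans (powR_jensen pr1 u0 u1 (fun j => powR_ge0 _ _)) _.
    apply: ler_sum => j _; rewrite -powRrM mulrCA mulfV ?gt_eqF//.
    by rewrite mulr1.
  apply: (@le_trans _ _ ((n%:R * A1) `^ (p - r) * rad r x)).
    rewrite /rad -iid_avgZ; apply: iid_avg_le => [b|e]; first exact: coin_ge0.
    have -> v : v `^ p = v `^ (p - r) * v `^ r :> R.
      by rewrite -powRD subrK// gt_eqF.
    rewrite ler_wpM2r ?powR_ge0//.
    apply: le_powR; rewrite ?subr_ge0//.
    rewrite mulVKf ?gt_eqF//; apply: le_trans (ler_norm_sum _ _ _) _.
    by apply: ler_sum => j _; rewrite normrZ normrX normrN1 expr1n mul1r.
  apply: le_trans (ler_wpM2l (powR_ge0 _ _) typ) _.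
  rewrite powRM//.
  apply: (@le_trans _ _ (n%:R `^ (p - r) * (M `^ p^-1) `^ (p - r) *
     (T `^ r * (n%:R * M `^ (r / p))))).
    apply: ler_pM; rewrite ?mulr_ge0 ?powR_ge0//.
    - by apply: sumr_ge0 => j _; exact: powR_ge0.
    - by rewrite ler_wpM2l ?powR_ge0// le_powR// subr_ge0.
    - by rewrite ler_wpM2l ?powR_ge0.
  have MM : (M `^ p^-1) `^ (p - r) * M `^ (r / p) = M.
    have e : p^-1 * (p - r) + r / p = 1 by field; rewrite gt_eqF.
    by rewrite -powRrM -powRD e ?powRr1// oner_eq0.
  rewrite -[leRHS]mulrA -[X in _ <= _ * (_ * X)]MM le_eqVlt; apply/orP; left.
  by apply/eqP; ring.
(* For [p < r], Jensen over the signs raises the exponent to [r], and the [l_r] norm is at most the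
   [l_p] norm. *)
- rewrite mulrA -(mulrA _ _ (_ `^ p)) npow subrr powRr0 mul1r.
  rewrite -mulrA -MS; set S := \sum_j _.
  have rp1 : 1 <= r / p by rewrite ler_pdivlMr// mul1r ltW.
  have rad0 : 0 <= rad p x by apply: rad_ge0; exact: ltW.
  have Sr : \sum_j `|x j| `^ r <= S `^ (r / p).
    have -> : S `^ (r / p) = \sum_j `|x j| `^ p * S `^ (r / p - 1).
      rewrite -mulr_suml -/S mulr_powRB1//.
      by rewrite divr_gt0.
    apply: ler_sum => j _.
    have pr' : p + p * (r / p - 1) = r by field; rewrite gt_eqF.
    have -> v : v `^ r = v `^ p * v `^ (p * (r / p - 1)) :> R.
      by rewrite -powRD pr'// gt_eqF.
    rewrite ler_wpM2l ?powR_ge0// powRrM le_powR ?subr_ge0 ?powR_ge0//.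
    rewrite /S (bigD1 j)//= lerDl sumr_ge0// => i _; exact: powR_ge0.
  have -> : rad p x = (rad p x `^ (r / p)) `^ (p / r).
    by rewrite powR_divK.
  have -> : T `^ p * S = ((T `^ r) * S `^ (r / p)) `^ (p / r).
    rewrite powRM ?powR_ge0// powR_divK// -powRrM; congr (_ `^ _ * _).
    by field; rewrite gt_eqF.
  apply: le_powR; rewrite ?powR_ge0 ?divr_ge0 ?(ltW p0) ?(ltW r0)//.
  apply: le_trans (ler_wpM2l (powR_ge0 T r) Sr).
  apply: le_trans typ; rewrite /rad /iid_avg.
  apply: le_trans (powR_jensen rp1 _ _ _) _.
  - by move=> e; apply: iid_weight_ge0; exact: coin_ge0.
  - exact/iid_weight_sum/coin_sum.
  - by move=> e; exact: powR_ge0.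
  apply: ler_sum => e _; rewrite -powRrM mulrCA mulfV ?gt_eqF// mulr1//.
Qed.

Lemma exists_small_type_const (q T : R) : 1 < q ->
  exists2 n : nat, (0 < n)%N & T `^ q * n%:R `^ (1 - q) < 1.
Proof.
move=> q1; have q10 : 0 < q - 1 by rewrite subr_gt0.
(* [B ^ (q - 1) = T ^ q], so every integer above [B] works. *)
set B := (T `^ q) `^ (q - 1)^-1.
exists (Num.bound B).+1 => //.
have Bn : B < (Num.bound B).+1%:R.
  apply: lt_trans (_ : (Num.bound B)%:R < _); last by rewrite ltr_nat.
  by apply: archi_boundP; exact: powR_ge0.
rewrite -opprB powRN ltr_pdivrMr ?powR_gt0 ?ltr0n// mul1r.
rewrite -[ltLHS](powRrMK (lt0r_neq0 q10)) ?powR_ge0//.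
by apply: gt0_ltr_powR => //; rewrite nnegrE ?powR_ge0.
Qed.

(* If signed sums of the [y_i] were no larger than the [y_i], the vectors
   [x_l = \sum_i e_i i_l y_i] would span a copy of [l_1^k]: the coefficient of
   [y_d] in [\sum_l d_l x_l] is [k] up to sign. The hypothesis excludes it. *)
Lemma rad_cube_lower (k : nat) (c : R) : (0 < k)%N -> 0 <= c ->
  (forall x : 'I_k -> X, rad p x <=
     c * (k%:R `^ p * (k%:R^-1 * \sum_l `|x l| `^ p))) ->
  forall y : cube k -> X,
    #|cube k|%:R^-1 * \sum_i `|y i| `^ p <= c * rad p y.
Proof.
move=> k0 c0 H y.
have p1 : 1 <= p by exact: ltW.
have k0' : 0 < k%:R :> R by rewrite ltr0n.
have kp : 0 < k%:R `^ p :> R by rewrite powR_gt0.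
rewrite -(ler_pM2l kp).
pose x (e : {ffun cube k -> bool}) (l : 'I_k) :=
  \sum_i (-1) ^+ (e i) *: ((-1) ^+ (i l) *: y i).
(* Average over [e]: above, [H] applies and each [x e l] has [p]-th moment [rad p y]; below, one
   coordinate of the sum is isolated. *)
apply: (@le_trans _ _ (iid_avg (@coin R) (fun e => rad p (x e)))); last first.
  apply: (@le_trans _ _ (iid_avg (@coin R) (fun e =>
      c * (k%:R `^ p * (k%:R^-1 * \sum_l `|x e l| `^ p))))).
    by apply: iid_avg_le => [b|e]; [exact: coin_ge0|exact: H].
  rewrite !iid_avgZ iid_avg_sum.
  rewrite (eq_bigr (fun=> rad p y)) => [|l _]; last exact: (rad_sign _ (fun i : cube k => i l)).
  rewrite sumr_const card_ord -[X in k%:R^-1 * X]mulr_natl mulKf ?gt_eqF//.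
  by rewrite mulrCA.
rewrite /rad iid_avgC.
have -> : #|cube k|%:R^-1 * \sum_i `|y i| `^ p =
    iid_avg (@coin R) (fun d : cube k => `|y d| `^ p).
  by rewrite iid_coinE card_ffun card_bool natrX.
rewrite -iid_avgZ; apply: iid_avg_le => [b|d]; first exact: coin_ge0.
rewrite -powRM ?(ltW k0')//.
(* The coefficient of [y i] in the signed sum of the [x e l], up to the sign of [e i]; it equals [k]
   at [i = d]. *)
pose z (i : cube k) := (\sum_l (-1) ^+ (d l) * (-1) ^+ (i l)) *: y i.
have -> : k%:R * `|y d| = `|z d|.
  rewrite /z; under eq_bigr => l _ do rewrite -signr_addb addbb expr0.
  by rewrite sumr_const card_ord normrZ ger0_norm// ltW.
apply: le_trans (rad_coord p1 z d) _.
rewrite le_eqVlt; apply/orP; left; apply/eqP; apply: eq_iid_avg => // e.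
congr (`|_| `^ p); rewrite /x /z.
under [RHS]eq_bigr => l _ do rewrite scaler_sumr.
rewrite exchange_big/=; apply: eq_bigr => i _.
rewrite scaler_suml scaler_sumr; apply: eq_bigr => l _.
by rewrite !scalerA mulrCA mulrA.
Qed.

(** The minimum of [p] and the type still exceeds 1, so a large [k] brings the constant below 1. *)
Lemma nontrivial_type_rad_lower : nontrivial_type X ->
  exists k : nat, exists2 c : R, (0 < k)%N /\ 0 < c < 1 &
    forall y : cube k -> X,
      #|cube k|%:R^-1 * \sum_i `|y i| `^ p <= c * rad p y.
Proof.
case=> r [r1 [_ [T [T0 typ]]]].
have q1 : 1 < Num.min p r by rewrite lt_min p_gt1.
have [k k0 ck] := exists_small_type_const T q1.
exists k; exists (T `^ Num.min p r * k%:R `^ (1 - Num.min p r)).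
  by rewrite ck mulr_gt0 ?powR_gt0// ltr0n.
apply: rad_cube_lower => // [|x]; first by rewrite mulr_ge0 ?powR_ge0.
apply: rad_le_of_type => //.
by have := typ k x; rewrite cube_avgE.
Qed.

End TypeConsequences.

(** * The noise kernel, its score and symmetrization *)

Section NoiseKernel.
Context (R : realType) (X : normedModType R) (p : R).
Hypothesis p_gt1 : 1 < p.

Lemma iid_avg_marginal (J A : finType) (u f : A -> R) (j : J) :
  \sum_b u b = 1 -> iid_avg u (fun a : {ffun J -> A} => f (a j)) = \sum_b u b * f b.
Proof.
move=> u1.
transitivity (\sum_(a : {ffun J -> A})
    \prod_i (u (a i) * (if i == j then f (a i) else 1))).
  apply: eq_bigr => a _; rewrite big_split/= -big_mkcond/= big_pred1_eq//.
rewrite -(bigA_distr_bigA (fun i b => u b * (if i == j then f b else 1))).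
rewrite (bigD1 j)//= eqxx [X in _ * X]big1 ?mulr1// => i /negbTE ->.
by under eq_bigr do rewrite mulr1.
Qed.

(** By mean zero the sum is its own expectation over an independent copy [a']; Jensen takes this
    expectation out of the power. *)
Lemma symmetrization (J A : finType) (u f : A -> R) (x : J -> X) :
  (forall b, 0 <= u b) -> \sum_b u b = 1 -> \sum_b u b * f b = 0 ->
  iid_avg u (fun a : {ffun J -> A} => `|\sum_j f (a j) *: x j| `^ p) <=
  iid_avg u (fun a : {ffun J -> A} => iid_avg u (fun a' : {ffun J -> A} =>
    `|\sum_j (f (a j) - f (a' j)) *: x j| `^ p)).
Proof.
move=> u0 u1 uf; apply: iid_avg_le => // a.
have -> : \sum_j f (a j) *: x j = \sum_(a' : {ffun J -> A})
    (\prod_j u (a' j)) *: (\sum_j (f (a j) - f (a' j)) *: x j).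
  under [RHS]eq_bigr do rewrite scaler_sumr.
  rewrite exchange_big/=; apply: eq_bigr => j _.
  under [RHS]eq_bigr do rewrite scalerA.
  rewrite -scaler_suml; congr (_ *: _).
  under [RHS]eq_bigr do rewrite mulrBr.
  rewrite sumrB -mulr_suml iid_weight_sum// mul1r.
  by have := iid_avg_marginal f j u1; rewrite uf /iid_avg => ->; rewrite subr0.
apply: norm_jensen; [exact: ltW|by move=> b; exact: iid_weight_ge0|].
exact: iid_weight_sum.
Qed.

(** Law of a random sign of mean [rho], in terms of its bit. *)
Definition noise (rho : R) (b : bool) : R := (1 + rho * (-1) ^+ b) / 2.
(** The derivative in [rho] of the logarithm of [noise rho b]. *)
Definition noise_score (rho : R) (b : bool) : R := (-1) ^+ b / (1 + rho * (-1) ^+ b).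

Lemma noise_ge0 rho b : 0 <= rho < 1 -> 0 <= noise rho b.
Proof. by case/andP=> r0 r1; case: b; rewrite /noise /= ?expr0 ?expr1; lra. Qed.

Lemma noise_sum rho : \sum_b noise rho b = 1.
Proof. by rewrite big_bool /noise /= ?expr0 ?expr1; lra. Qed.

Lemma noise_scoreE rho b : 0 <= rho < 1 ->
  noise rho b * noise_score rho b = (-1) ^+ b / 2.
Proof.
case/andP=> r0 r1; rewrite /noise /noise_score; case: b; rewrite /= ?expr0 ?expr1;
  by field; rewrite gt_eqF//; lra.
Qed.

Lemma noise_score_mean0 rho : 0 <= rho < 1 ->
  \sum_b noise rho b * noise_score rho b = 0.
Proof. by move=> r01; rewrite big_bool/= !noise_scoreE//= ?expr0 ?expr1; lra. Qed.

(** [None] is an index left out, [Some c] one selected with sign bit [c]: selection and sign form a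
    single variable. *)
Definition opt_sign (b : option bool) : R := if b is Some c then (-1) ^+ c else 0.

Definition opt_law (s : R) (b : option bool) : R := if b is Some _ then s / 2 else 1 - s.

Lemma selE (J : finType) s (x : J -> X) :
  sel p s x = iid_avg (opt_law s)
    (fun b : {ffun J -> option bool} => `|\sum_j opt_sign (b j) *: x j| `^ p).
Proof.
pose f (t e : bool) := if t then Some e else None.
pose G (b : {ffun J -> option bool}) := `|\sum_j opt_sign (b j) *: x j| `^ p.
transitivity (iid_avg (bern s) (fun t : {ffun J -> bool} =>
  iid_avg (@coin R) (fun e : {ffun J -> bool} => G [ffun j => f (t j) (e j)]))).
  apply: eq_iid_avg => // t; apply: eq_iid_avg => // e; congr (`|_| `^ p).
  apply: eq_bigr => j _; rewrite ffunE scalerA.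
  by rewrite /f; case: (t j); rewrite /= ?mulr1 ?mulr0.
rewrite (iid_avg_push2 f).
apply: eq_iid_avg => // b.
rewrite (big_mkcond (fun i => _ == _)).
rewrite -(pair_bigA _ (fun t e : bool =>
  if f t e == b then bern s t * @coin R e else 0))/=.
rewrite !big_bool/= /coin /f; case: b => [[]|] /=; lra.
Qed.

(** Two independent scores differ only if their bits do, and then by [2 / (1 - rho ^ 2)] up to sign,
    each sign having probability [(1 - rho ^ 2) / 4]. *)
Lemma noise_score_sel (J : finType) rho (x : J -> X) : 0 <= rho < 1 ->
  iid_avg (noise rho)
    (fun a : {ffun J -> bool} => `|\sum_j noise_score rho (a j) *: x j| `^ p) <=
  (2 / (1 - rho ^+ 2)) `^ p * sel p ((1 - rho ^+ 2) / 2) x.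
Proof.
move=> r01; case/andP: (r01) => r0 r1.
have noise0 b : 0 <= noise rho b by exact: noise_ge0.
apply: le_trans (symmetrization x noise0 (noise_sum rho) (noise_score_mean0 r01)) _.
set c := 2 / _.
have c0 : 0 <= c by rewrite divr_ge0// subr_ge0 expr_le1// ltW.
pose f (b b' : bool) := if b == b' then None else Some b.
have fE b b' : noise_score rho b - noise_score rho b' = c * opt_sign (f b b').
  rewrite /noise_score /c /f; case: b; case: b'; rewrite /= ?expr0 ?expr1 ?subrr ?mulr0//;
  by field; rewrite -?andbA !gt_eqF//; nra.
rewrite le_eqVlt; apply/orP; left; apply/eqP.
pose G (b : {ffun J -> option bool}) :=
  c `^ p * `|\sum_j opt_sign (b j) *: x j| `^ p.
transitivity (iid_avg (noise rho) (fun a : {ffun J -> bool} =>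
  iid_avg (noise rho) (fun a' : {ffun J -> bool} => G [ffun j => f (a j) (a' j)]))).
  apply: eq_iid_avg => // a; apply: eq_iid_avg => // a'.
  rewrite /G -powRM// -[X in X * _]ger0_norm// -normrZ; congr (`|_| `^ p).
  rewrite scaler_sumr; apply: eq_bigr => j _; by rewrite ffunE scalerA fE.
rewrite (iid_avg_push2 f) selE -iid_avgZ; apply: eq_iid_avg => // b.
rewrite (big_mkcond (fun i => _ == _)).
rewrite -(pair_bigA _ (fun i j : bool =>
  if f i j == b then noise rho i * noise rho j else 0))/=.
rewrite !big_bool/= /noise /f; case: b => [[]|] /=; rewrite ?expr0 ?expr1; by field.
Qed.

End NoiseKernel.

(** * Riemann sums of derivatives of polynomials *)

Section PolynomialRiemannSums.
Context (R : realType).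

(** The induction is joint: for [q * 'X + c] the Lipschitz bound uses the sup bound of [q], and the
    second-order bound uses the Lipschitz one. *)
Lemma poly_taylor1 (q : {poly R}) : exists2 C : R, 0 <= C &
  forall x h, 0 <= x <= 1 -> 0 <= h <= 1 ->
    [/\ `|q.[x + h]| <= C, `|q.[x + h] - q.[x]| <= C * h &
        `|q.[x + h] - q.[x] - h * q^`().[x]| <= C * h ^+ 2].
Proof.
elim/poly_ind: q => [|q c [C C0 IH]].
  exists 0 => // x h _ _; rewrite deriv0 !horner0 mulr0 !subr0 !normr0 !mul0r.
  by split.
exists (2 * C + `|c|) => [|x h /andP[x0 x1] /andP[h0 h1]].
  by rewrite addr_ge0 ?mulr_ge0.
have [||H1 H2 H3] := IH x h; rewrite ?x0 ?h0//.
rewrite derivMXaddC !hornerMXaddC hornerD hornerMX.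
set a := q.[x] in H1 H2 H3 *; set b := q.[x + h] in H1 H2 H3 *.
set d := (q^`()).[x] in H1 H2 H3 *.
have c0 := normr_ge0 c.
have Ch : 0 <= C * h by rewrite mulr_ge0.
have Chh : 0 <= C * h ^+ 2 by rewrite mulr_ge0// exprn_ge0.
have xba : `|x * (b - a)| <= C * h.
  by rewrite normrM ger0_norm// (le_trans _ H2)// ler_piMl.
have hb : `|h * b| <= C * h by rewrite normrM ger0_norm// mulrC ler_wpM2r.
split.
- apply: le_trans (ler_normD _ _) _; rewrite lerD2r normrM.
  have : `|x + h| <= 2 by rewrite ger0_norm ?addr_ge0//; lra.
  by move=> /(ler_pM (normr_ge0 _) (normr_ge0 _) H1); rewrite (mulrC C).
- have -> : b * (x + h) + c - (a * x + c) = x * (b - a) + h * b by ring.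
  apply: le_trans (ler_normD _ _) _.
  have : 0 <= `|c| * h by rewrite mulr_ge0.
  by lra.
- have -> : b * (x + h) + c - (a * x + c) - h * (a + d * x) =
      x * (b - a - h * d) + h * (b - a) by ring.
  apply: le_trans (ler_normD _ _) _.
  have H4 : `|x * (b - a - h * d)| <= C * h ^+ 2.
    by rewrite normrM ger0_norm// (le_trans _ H3)// ler_piMl.
  have H5 : `|h * (b - a)| <= C * h ^+ 2.
    by rewrite normrM ger0_norm// expr2 mulrA mulrC ler_wpM2r.
  have H6 : C * h ^+ 2 + C * h ^+ 2 <= (2 * C + `|c|) * h ^+ 2.
    by rewrite (mulrDl (2 * C)) -mulrA mulr_natl mulr2n lerDl mulr_ge0// exprn_ge0.
  exact: le_trans (lerD H4 H5) H6.
Qed.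

(** Telescoping over [L] cells, each with error [C / L ^ 2]. The nodes are left endpoints, so 1,
    where the noise estimates degenerate, is never a node. *)
Lemma poly_riemann_sum (q : {poly R}) : exists2 C : R, 0 <= C &
  forall L : nat, (0 < L)%N ->
    `|q.[1] - q.[0] - \sum_(j < L) L%:R^-1 * q^`().[1 - j.+1%:R / L%:R]| <= C / L%:R.
Proof.
have [C C0 H] := poly_taylor1 q; exists C => // L L0.
have L0' : 0 < L%:R :> R by rewrite ltr0n.
have -> : q.[1] - q.[0] = \sum_(j < L) (q.[1 - j%:R / L%:R] - q.[1 - j.+1%:R / L%:R]).
  rewrite -(big_mkord xpredT (fun j => q.[1 - j%:R / L%:R] - q.[1 - j.+1%:R / L%:R])).
  under eq_bigr => j _ do rewrite -opprB.
  rewrite sumrN (telescope_sumr (fun j => q.[1 - j%:R / L%:R]))//.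
  by rewrite opprB mul0r subr0 divff ?gt_eqF// subrr.
rewrite -sumrB.
have -> : C / L%:R = \sum_(j < L) C * (L%:R^-1) ^+ 2.
  by rewrite sumr_const card_ord -[RHS]mulr_natl; field; rewrite gt_eqF.
apply: le_trans (ler_norm_sum _ _ _) _; apply: ler_sum => j _.
have jL : j.+1%:R / L%:R <= 1 :> R by rewrite ler_pdivrMr// mul1r ler_nat.
have j0 : 0 <= j.+1%:R / L%:R :> R by rewrite divr_ge0 ?ltW.
have Li : 0 <= (L%:R^-1 : R) <= 1.
  by rewrite invr_ge0 ltW//= invf_le1// ler1n.
have jL' : 0 <= (1 : R) - j.+1%:R / L%:R <= 1 by rewrite subr_ge0 jL gerBl.
have [_ _] := H _ _ jL' Li.
suff -> : 1 - j.+1%:R / L%:R + L%:R^-1 = 1 - j%:R / L%:R :> R by [].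
by rewrite -natr1 mulrDl mul1r opprD addrA subrK.
Qed.

Lemma deriv_prod (I : finType) (P : I -> {poly R}) :
  (\prod_i P i)^`() = \sum_j (P j)^`() * \prod_(i | i != j) P i.
Proof.
suff H s : uniq s -> (\prod_(i <- s) P i)^`() =
    \sum_(j <- s) (P j)^`() * \prod_(i <- s | i != j) P i.
  by rewrite H// index_enum_uniq.
elim: s => [_|a s IH /= /andP[as_ us]]; first by rewrite !big_nil derivC.
rewrite !big_cons derivM IH// eqxx /=; congr (_ * _ + _).
  rewrite big_seq [RHS]big_seq_cond; apply: eq_bigl => i.
  by case: eqVneq => [->|]; rewrite ?andbT// (negbTE as_).
rewrite mulr_sumr big_seq [RHS]big_seq; apply: eq_bigr => j js.
have aj : a != j by apply: contraNneq as_ => ->.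
by rewrite big_cons aj mulrCA.
Qed.

End PolynomialRiemannSums.

(** * The noise operator on the cube and its derivative *)

Section HeatFlow.
Context (R : realType) (X : completeNormedModType R) (n : nat).
Implicit Types (e xi : cube n) (f g : cube n -> X).

Definition cube_xor e xi : cube n := [ffun i => e i (+) xi i].

Lemma cube_xorC e xi : cube_xor e xi = cube_xor xi e.
Proof. by apply/ffunP => i; rewrite !ffunE addbC. Qed.

Lemma cube_xorK xi : involutive (cube_xor^~ xi).
Proof. by move=> e; apply/ffunP => i; rewrite !ffunE -addbA addbb addbF. Qed.

Lemma flipK (j : 'I_n) : involutive (flip j).
Proof.
by move=> e; apply/ffunP => i; rewrite !ffunE; case: eqP => // _; rewrite negbK.
Qed.

Lemma flip_xor (j : 'I_n) e xi : flip j (cube_xor e xi) = cube_xor e (flip j xi).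
Proof.
by apply/ffunP => i; rewrite !ffunE; case: eqP => // _; rewrite addbN.
Qed.

Lemma sum_cube_xor (V : nmodType) (F : cube n -> V) xi :
  \sum_e F (cube_xor e xi) = \sum_e F e.
Proof.
by rewrite [RHS](reindex (cube_xor^~ xi))//; exists (cube_xor^~ xi) => e _; exact: cube_xorK.
Qed.

Lemma sum_flip (V : nmodType) (F : cube n -> V) j :
  \sum_e F (flip j e) = \sum_e F e.
Proof.
by rewrite [RHS](reindex (flip j))//; exists (flip j) => e _; exact: flipK.
Qed.

(** Summation by parts: [flip j] preserves sums over the cube, so the difference passes to the
    kernel. *)
Lemma cube_partial_parts (j : 'I_n) (a : cube n -> R) f e :
  \sum_xi a xi *: cube_partial j f (cube_xor e xi) =
  \sum_xi (2^-1 * (a xi - a (flip j xi))) *: f (cube_xor e xi).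
Proof.
under eq_bigr => xi _ do rewrite /cube_partial flip_xor scalerA scalerBr.
rewrite sumrB.
under [RHS]eq_bigr => xi _ do rewrite mulrBr scalerBl.
rewrite sumrB; congr (_ - _).
  by apply: eq_bigr => xi _; rewrite mulrC.
rewrite -(sum_flip _ j) /=; apply: eq_bigr => xi _.
by rewrite flipK mulrC.
Qed.

(** The noise kernel as a polynomial in the correlation, so that only polynomials are integrated
    over [rho]. *)
Definition noise_poly xi : {poly R} := \prod_j (2^-1 *: (1 + (-1) ^+ (xi j) *: 'X)).

Definition dnoise (rho : R) (j : 'I_n) xi : R :=
  (-1) ^+ (xi j) / 2 * \prod_(i | i != j) noise rho (xi i).

Lemma noise_polyE xi rho : (noise_poly xi).[rho] = \prod_j noise rho (xi j).
Proof.
rewrite horner_prod; apply: eq_bigr => j _; rewrite !hornerE /noise mulrC.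
by rewrite (mulrC rho).
Qed.

Lemma noise_poly1 xi : (noise_poly xi).[1] = (xi == [ffun=> false])%:R.
Proof.
rewrite noise_polyE; case: eqVneq => [->|/eqP ne].
  by rewrite big1// => j _; rewrite ffunE /noise /= expr0; lra.
have [j] : exists j, xi j.
  apply: contrapT => h; apply: ne; apply/ffunP => j; rewrite ffunE.
  by apply/negbTE/negP => xj; apply: h; exists j.
by move=> xj; rewrite (bigD1 j)//= xj /noise /= expr1 mul1r subrr mul0r mul0r.
Qed.

Lemma noise_poly0 xi : (noise_poly xi).[0] = (2^-1) ^+ n.
Proof.
rewrite noise_polyE -[in RHS](card_ord n) -prodr_const; apply: eq_bigr => j _.
by rewrite /noise mul0r addr0 mul1r.
Qed.

Lemma deriv_noise_poly xi rho :
  (noise_poly xi)^`().[rho] = \sum_j dnoise rho j xi.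
Proof.
rewrite deriv_prod horner_sum; apply: eq_bigr => j _.
rewrite hornerM horner_prod; congr (_ * _).
  rewrite derivZ derivD derivZ derivX -polyC1 derivC add0r !hornerZ hornerC.
  by rewrite mulr1 mulrC.
apply: eq_bigr => i _; rewrite !hornerE /noise mulrC.
by rewrite (mulrC rho).
Qed.

Lemma dnoise_diff rho i j xi :
  dnoise rho i xi - dnoise rho i (flip j xi) =
  dnoise rho j xi - dnoise rho j (flip i xi).
Proof.
have [->//|ij] := eqVneq i j.
(* Flipping [l] changes only the factor at [l], by [rho] times its sign; the outcome is symmetric in
   [k] and [l]. *)
have D k l : k != l -> dnoise rho k xi - dnoise rho k (flip l xi) =
    rho * ((-1) ^+ (xi k) / 2) * (-1) ^+ (xi l) *
    \prod_(h | (h != k) && (h != l)) noise rho (xi h).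
  move=> kl; rewrite /dnoise (bigD1 l) 1?eq_sym//=.
  rewrite [X in _ - _ * X](bigD1 l) 1?eq_sym//= !ffunE eqxx (negbTE kl).
  under [X in _ - _ * (_ * X)]eq_bigr => h /andP[_ /negbTE hl] do rewrite ffunE hl.
  rewrite -mulrBr mulrA -mulrBl /noise.
  by case: (xi l); rewrite /= ?expr0 ?expr1; field.
rewrite D// D 1?eq_sym//.
under eq_bigl => h do rewrite andbC.
by congr (_ * _); ring.
Qed.

(** The integrand [G_rho], with [dnoise] in place of kernel times score to avoid dividing by
    [1 + rho xi]. *)
Definition heat_derivative (f : 'I_n -> cube n -> X) (rho : R) e : X :=
  \sum_j \sum_xi dnoise rho j xi *: cube_laplacian (f j) (cube_xor e xi).

(* [dnoise rho i] is the [i]-th partial derivative of the kernel divided by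
   [rho]; moving [\partial_j] onto the kernel and [\partial_i] back trades the
   Laplacian of the kernel for the Laplacian of the functions. *)
Lemma heat_derivativeE (f : 'I_n -> cube n -> X) rho e :
  \sum_xi (noise_poly xi)^`().[rho] *:
    (\sum_j cube_partial j (f j) (cube_xor e xi)) = heat_derivative f rho e.
Proof.
under eq_bigr => xi _ do rewrite deriv_noise_poly scaler_sumr.
rewrite exchange_big /heat_derivative; apply: eq_bigr => j _.
under eq_bigr => xi _ do rewrite scaler_suml.
under [RHS]eq_bigr => xi _ do rewrite /cube_laplacian scaler_sumr.
rewrite exchange_big [RHS]exchange_big; apply: eq_bigr => i _ /=.
rewrite !cube_partial_parts; apply: eq_bigr => xi _.
by rewrite dnoise_diff.
Qed.

(** At 1 the kernel is the unit mass at the identity; at 0 it is uniform, and partial derivatives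
    have uniform mean zero. *)
Lemma sum_cube_partial_noise (f : 'I_n -> cube n -> X) e :
  \sum_xi ((noise_poly xi).[1] - (noise_poly xi).[0]) *:
    (\sum_j cube_partial j (f j) (cube_xor e xi)) =
  \sum_j cube_partial j (f j) e.
Proof.
under eq_bigr => xi _ do rewrite noise_poly0 noise_poly1 scalerBl.
rewrite sumrB -scaler_sumr exchange_big/= [X in _ - _ *: X]big1 => [|j _].
  rewrite scaler0 subr0 (bigD1 [ffun=> false])//= eqxx scale1r [X in _ + X]big1 ?addr0.
    by apply: eq_bigr => j _; congr cube_partial; apply/ffunP => i; rewrite !ffunE addbF.
  by move=> xi /negbTE ->; rewrite scale0r.
under eq_bigr => xi _ do rewrite cube_xorC.
rewrite (sum_cube_xor (cube_partial j (f j))) /cube_partial -scaler_sumr sumrB.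
by rewrite sum_flip subrr scaler0.
Qed.

(** [B] may depend on [n] and [f], since [L] tends to infinity with these fixed. *)
Lemma heat_riemann_sum (f : 'I_n -> cube n -> X) : exists2 B : R, 0 <= B &
  forall L : nat, (0 < L)%N -> forall e,
    `|\sum_j cube_partial j (f j) e -
      \sum_(k < L) L%:R^-1 *: heat_derivative f (1 - k.+1%:R / L%:R) e| <= B / L%:R.
Proof.
pose V xi e := \sum_j cube_partial j (f j) (cube_xor e xi).
have H xi := poly_riemann_sum (noise_poly xi).
pose C xi := sval (cid2 (H xi)).
have C0 xi : 0 <= C xi by rewrite /C; case: (cid2 _).
have CH xi L : (0 < L)%N -> `|(noise_poly xi).[1] - (noise_poly xi).[0] -
    \sum_(j < L) L%:R^-1 * (noise_poly xi)^`().[1 - j.+1%:R / L%:R]| <= C xi / L%:R.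
  by move=> L0; rewrite /C; case: (cid2 _) => /= c _; exact.
(* Summing over [e] makes the constant uniform in [e]. *)
exists (\sum_e \sum_xi C xi * `|V xi e|).
  by do 2!(apply: sumr_ge0 => ? _); rewrite mulr_ge0.
move=> L L0 e.
rewrite -sum_cube_partial_noise.
under [X in _ - X]eq_bigr => k _ do rewrite -heat_derivativeE scaler_sumr.
rewrite exchange_big/= -sumrB.
rewrite (eq_bigr (fun xi => ((noise_poly xi).[1] - (noise_poly xi).[0] -
    \sum_(j < L) L%:R^-1 * (noise_poly xi)^`().[1 - j.+1%:R / L%:R]) *: V xi e));
  last first.
  move=> xi _; rewrite [in RHS]scalerBl; congr (_ - _); rewrite scaler_suml.
  by apply: eq_bigr => k _; rewrite scalerA.
apply: le_trans (ler_norm_sum _ _ _) _.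
apply: (@le_trans _ _ (\sum_xi C xi * `|V xi e| / L%:R)).
  apply: ler_sum => xi _; rewrite normrZ mulrAC ler_wpM2r//; exact: CH.
rewrite -mulr_suml ler_wpM2r ?invr_ge0//.
rewrite [leRHS](bigD1 e)//= lerDl.
by do 2!(apply: sumr_ge0 => ? _); rewrite mulr_ge0.
Qed.

End HeatFlow.

(** * Harmonic sums with geometric decay over blocks *)

Section HarmonicWeights.
Context (R : realType) (m : nat) (th : R).
Hypothesis m_gt1 : (1 < m)%N.
Hypothesis th01 : 0 < th < 1.

(* For [a < N] and [m ^ (N - a - 1) < j <= m ^ (N - a)] the value is [th ^ a]. *)
Fixpoint decay_weight (N j : nat) : R :=
  if N is N'.+1 then
    if (j <= m ^ N')%N then th * decay_weight N' j else 1
  else 1.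

Lemma decay_weight_gt0 N j : 0 < decay_weight N j.
Proof.
case/andP: th01 => th0 _.
by elim: N => //= N IH; case: ifP => // _; rewrite mulr_gt0.
Qed.

(** The new block has at most [m ^ N.+1] terms, each at most [1 / m ^ N], and the older sum is
    multiplied by [th]; [m / (1 - th)] is the fixed point of this recursion. *)
Lemma decay_weight_sum N :
  \sum_(j < m ^ N) decay_weight N j.+1 / j.+1%:R <= m%:R / (1 - th).
Proof.
case/andP: th01 => th0 th1.
have d0 : 0 < 1 - th by rewrite subr_gt0.
have m0 : 0 < m%:R :> R by rewrite ltr0n ltnW.
have m1 : 1 <= m%:R :> R by rewrite ler1n ltnW.
elim: N => [|N IH].
  rewrite expn0 big_ord1 /= divr1 ler_pdivlMr// mul1r.
  by apply: le_trans m1; rewrite gerBl ltW.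
have le_pow : (m ^ N <= m ^ N.+1)%N by rewrite leq_exp2l.
rewrite -(big_mkord xpredT (fun j => decay_weight N.+1 j.+1 / j.+1%:R)).
rewrite (big_cat_nat (leq0n _) le_pow)/=.
have -> : m%:R / (1 - th) = th * (m%:R / (1 - th)) + m%:R :> R.
  by field; rewrite gt_eqF.
apply: lerD.
  rewrite big_mkord; apply: le_trans (ler_wpM2l (ltW th0) IH).
  rewrite mulr_sumr; apply: ler_sum => j _.
  by rewrite ltn_ord mulrA.
have p0 : 0 < (m ^ N)%:R :> R by rewrite ltr0n expn_gt0 ltnW.
apply: (@le_trans _ _ (\sum_(m ^ N <= j < m ^ N.+1) (m ^ N)%:R^-1)).
  rewrite !big_nat; apply: ler_sum => j /andP[j1 _].
  by rewrite ltnNge j1/= mul1r lef_pV2 ?posrE ?ltr0Sn// ler_nat leqW.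
rewrite sumr_const_nat -[leLHS]mulr_natl ler_pdivrMr// -natrM ler_nat -expnS.
exact: leq_subr.
Qed.

End HarmonicWeights.

(** * Pisier's inequality for a fixed family of functions *)

Section CubeInequality.
Context (R : realType) (X : completeNormedModType R) (p : R).
Hypothesis p_gt1 : 1 < p.

(** Minkowski's inequality from Jensen with weights [a i / A]; positivity of the bounds allows the
    weights to be inverted. *)
Lemma minkowski_iid (J I : finType) (F : I -> {ffun J -> bool} -> X) (a : I -> R) :
  (forall i, 0 < a i) -> 0 < \sum_i a i ->
  (forall i, iid_avg (@coin R) (fun e => `|F i e| `^ p) <= a i `^ p) ->
  iid_avg (@coin R) (fun e => `|\sum_i F i e| `^ p) <= (\sum_i a i) `^ p.
Proof.
move=> a0 A0 H; set A := \sum_i a i in A0 *.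
pose u i := a i / A.
have u0 i : 0 <= u i by rewrite divr_ge0// ltW.
have u1 : \sum_i u i = 1 by rewrite -mulr_suml divff// gt_eqF.
have uV i : 0 < u i by rewrite divr_gt0.
apply: (@le_trans _ _ (iid_avg (@coin R)
    (fun e => \sum_i u i * ((u i)^-1 `^ p * `|F i e| `^ p)))).
  apply: iid_avg_le => [b|e]; first exact: coin_ge0.
  have -> : \sum_i F i e = \sum_i u i *: ((u i)^-1 *: F i e).
    by apply: eq_bigr => i _; rewrite scalerA divff ?scale1r// gt_eqF.
  apply: le_trans (norm_jensen _ (ltW p_gt1) u0 u1) _.
  apply: ler_sum => i _; rewrite normrZ ger0_norm ?invr_ge0//.
  by rewrite powRM ?invr_ge0.
rewrite iid_avg_sum.
have -> : A `^ p = \sum_i u i * A `^ p by rewrite -mulr_suml u1 mul1r.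
apply: ler_sum => i _; rewrite !iid_avgZ ler_wpM2l//.
apply: le_trans (ler_wpM2l (powR_ge0 _ _) (H i)) _.
rewrite -powRM ?invr_ge0 ?(ltW (a0 i))// /u invf_div divfK//.
by rewrite gt_eqF.
Qed.

Variables (n : nat) (f : 'I_n -> cube n -> X).

Definition rad_laplacian : R :=
  iid_avg (@coin R) (fun e : cube n => rad p (fun j => cube_laplacian (f j) e)).

Lemma heat_derivative_le rho H : 0 <= rho < 1 -> 0 <= H ->
  (forall x : 'I_n -> X, sel p ((1 - rho ^+ 2) / 2) x <= H `^ p * rad p x) ->
  iid_avg (@coin R) (fun e : cube n => `|heat_derivative f rho e| `^ p) <=
  (2 / (1 - rho ^+ 2) * H) `^ p * rad_laplacian.
Proof.
move=> r01 H0 selH; case/andP: (r01) => r0 r1.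
have noise0 b : 0 <= noise rho b by exact: noise_ge0.
have c0 : 0 <= 2 / (1 - rho ^+ 2) by rewrite divr_ge0// subr_ge0 expr_le1// ltW.
pose g e (a : cube n) := `|\sum_j noise_score rho (a j) *: cube_laplacian (f j) e| `^ p.
apply: (@le_trans _ _ (iid_avg (@coin R) (fun e : cube n =>
   iid_avg (noise rho) (fun xi : cube n => g (cube_xor e xi) xi)))).
  apply: iid_avg_le => [b|e]; first exact: coin_ge0.
  have -> : heat_derivative f rho e = \sum_(xi : cube n) (\prod_j noise rho (xi j)) *:
      (\sum_j noise_score rho (xi j) *: cube_laplacian (f j) (cube_xor e xi)).
    rewrite /heat_derivative exchange_big; apply: eq_bigr => xi _ /=.
    rewrite scaler_sumr; apply: eq_bigr => j _; rewrite scalerA.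
    congr (_ *: _); rewrite /dnoise [in RHS](bigD1 j)//= [RHS]mulrAC.
    by rewrite noise_scoreE.
  apply: norm_jensen; [exact: ltW|by move=> xi; exact: iid_weight_ge0|].
  exact/iid_weight_sum/noise_sum.
rewrite iid_avgC.
(* For fixed [xi] the uniform measure is invariant under [e -> e xi], which decouples the two
   variables. *)
have -> : iid_avg (noise rho) (fun xi : cube n =>
      iid_avg (@coin R) (fun e : cube n => g (cube_xor e xi) xi)) =
    iid_avg (@coin R) (fun e : cube n => iid_avg (noise rho) (g e)).
  rewrite [RHS]iid_avgC; apply: eq_iid_avg => // xi.
  exact: (iid_coin_reindex (g^~ xi) (cube_xorK xi)).
rewrite /rad_laplacian -iid_avgZ; apply: iid_avg_le => [b|e]; first exact: coin_ge0.
apply: le_trans (noise_score_sel p_gt1 _ r01) _.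
by rewrite (powRM _ c0 H0) -mulrA ler_wpM2l ?powR_ge0.
Qed.

Variables (m : nat) (th : R).
Hypothesis m_gt1 : (1 < m)%N.
Hypothesis th01 : 0 < th < 1.
Hypothesis sel_inv : forall x : 'I_n -> X, sel p m%:R^-1 x <= th `^ p * rad p x.

(** While [j] fits under the next smaller power of [m], multiplying the parameter by [m] gains a
    factor [th ^ p]; after that [sel_le_rad] suffices. *)
Lemma sel_decay_weight N j s (x : 'I_n -> X) :
  (0 < j <= m ^ N)%N -> 0 <= s -> s <= j%:R / (m ^ N)%:R ->
  sel p s x <= decay_weight m th N j `^ p * rad p x.
Proof.
case/andP: th01 => th0 th1.
have p1 := ltW p_gt1.
have m0 : 0 < m%:R :> R by rewrite ltr0n ltnW.
have mN N' : 0 < (m ^ N')%:R :> R by rewrite ltr0n expn_gt0 ltnW.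
elim: N s => [|N IH] s /andP[j0 jm] s0 sj.
  rewrite /= powR1 mul1r; apply: sel_le_rad => //; rewrite s0/=.
  by apply: le_trans sj _; rewrite ler_pdivrMr// mul1r ler_nat.
rewrite /=; case: ifPn => jN; last first.
  rewrite powR1 mul1r; apply: sel_le_rad => //; rewrite s0/=.
  by apply: le_trans sj _; rewrite ler_pdivrMr// mul1r ler_nat.
have smj : s * m%:R <= j%:R / (m ^ N)%:R.
  rewrite -ler_pdivlMr//; apply: le_trans sj _.
  by rewrite expnS natrM invfM mulrA mulrAC.
have sm1 : s * m%:R <= 1.
  by apply: le_trans smj _; rewrite ler_pdivrMr// mul1r ler_nat.
apply: le_trans (sel_decay (ltnW m_gt1) (powR_ge0 th p) sel_inv _ s0 sm1) _.
rewrite (powRM _ (ltW th0) (ltW (decay_weight_gt0 m th01 N j))) -mulrA ler_wpM2l ?powR_ge0//.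
by apply: IH => //; [rewrite j0|rewrite mulr_ge0// ltW].
Qed.

Lemma pisier_ineq_approx : exists2 B : R, 0 <= B &
  forall (N : nat) (eps : R), 0 < eps ->
    iid_avg (@coin R) (fun e : cube n => `|\sum_j cube_partial j (f j) e| `^ p) `^ p^-1 <=
    2 * (m%:R / (1 - th)) * (rad_laplacian `^ p^-1 + eps) + B / (m ^ N)%:R.
Proof.
case/andP: th01 => th0 th1.
have p0 : 0 < p by exact: lt_trans p_gt1.
have pn0 : p != 0 by rewrite gt_eqF.
have m0 : 0 < m%:R :> R by rewrite ltr0n ltnW.
have [B B0 HB] := heat_riemann_sum f.
(* The added 1 keeps the error bound positive for [minkowski_iid]; [eps] does the same for [M]. *)
exists (B + 1) => [|N eps eps0]; first by rewrite addr_ge0.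
set L := (m ^ N)%N.
have L0 : (0 < L)%N by rewrite expn_gt0 ltnW.
have L0' : 0 < L%:R :> R by rewrite ltr0n.
have D0 : 0 <= rad_laplacian.
  apply: sumr_ge0 => e _; rewrite mulr_ge0 ?rad_ge0 ?iid_weight_ge0//.
  by move=> b; exact: coin_ge0.
set M := rad_laplacian `^ p^-1 + eps.
have M0 : 0 < M by rewrite ltr_wpDl ?powR_ge0.
have DM : rad_laplacian <= M `^ p.
  rewrite -[leLHS](powRrMK pn0 D0) le_powR ?powR_ge0 ?(ltW p0)//.
  by rewrite lerDl ltW.
set P := 2 * _.
have P0 : 0 < P by rewrite mulr_gt0// divr_gt0// subr_gt0.
(* At [rho = 1 - t] with [t = k.+1 / L], the factor [2 / (1 - rho ^ 2)] is at most [2 / t]; the step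
   [1 / L] turns this into [2 / k.+1]. *)
pose a (k : 'I_L) := 2 * (decay_weight m th N k.+1 / k.+1%:R) * M.
have a0 k : 0 < a k.
  by rewrite /a mulr_gt0// mulr_gt0// divr_gt0 ?decay_weight_gt0// ltr0n.
have aP : \sum_k a k <= P * M.
  rewrite -mulr_suml -mulr_sumr ler_wpM2r ?(ltW M0)// /P ler_wpM2l//.
  exact: decay_weight_sum.
have asum : 0 < \sum_k a k.
  rewrite (bigD1 (Ordinal L0))//= ltr_wpDr//.
  by apply: sumr_ge0 => k _; exact: ltW.
pose F (k : 'I_L) e := L%:R^-1 *: heat_derivative f (1 - k.+1%:R / L%:R) e.
have Fa k : iid_avg (@coin R) (fun e : cube n => `|F k e| `^ p) <= a k `^ p.
  set t := k.+1%:R / L%:R : R.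
  have t0 : 0 < t by rewrite divr_gt0// ltr0n.
  have t1 : t <= 1 by rewrite ler_pdivrMr// mul1r ler_nat.
  have r01 : 0 <= 1 - t < 1 by rewrite subr_ge0 t1/= gtrBl.
  have q0 : 0 < 1 - (1 - t) ^+ 2 by rewrite subr_gt0 expr_lt1//; case/andP: r01.
  (* [1 - (1 - t) ^ 2 = 2 t - t ^ 2] lies between [t] and [2 t]. *)
  have tq : t <= 1 - (1 - t) ^+ 2 by nra.
  have sE : (1 - (1 - t) ^+ 2) / 2 <= t by nra.
  have selt (x : 'I_n -> X) : sel p ((1 - (1 - t) ^+ 2) / 2) x <=
      decay_weight m th N k.+1 `^ p * rad p x.
    by apply: sel_decay_weight; [rewrite ltn_ord|rewrite divr_ge0 ?(ltW q0)|].
  have w0 := decay_weight_gt0 m th01 N k.+1.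
  have := heat_derivative_le r01 (ltW w0) selt.
  set c := 2 / _ * _ => Hk.
  have c0 : 0 <= c by rewrite mulr_ge0 ?(ltW w0)// divr_ge0// ltW.
  have -> : iid_avg (@coin R) (fun e : cube n => `|F k e| `^ p) = L%:R^-1 `^ p *
      iid_avg (@coin R) (fun e : cube n => `|heat_derivative f (1 - t) e| `^ p).
    rewrite -iid_avgZ; apply: eq_iid_avg => // e; rewrite -powRM ?invr_ge0 ?(ltW L0')//.
    by rewrite normrZ ger0_norm ?invr_ge0 ?(ltW L0').
  apply: le_trans (ler_wpM2l (powR_ge0 _ _) Hk) _.
  apply: (@le_trans _ _ (L%:R^-1 `^ p * (c `^ p * M `^ p))).
    by rewrite !ler_wpM2l ?powR_ge0.
  have cM0 : 0 <= c * M by exact: mulr_ge0 c0 (ltW M0).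
  have Li0 : 0 <= L%:R^-1 :> R by rewrite invr_ge0 ltW.
  rewrite -(powRM _ c0 (ltW M0)) -(powRM _ Li0 cM0).
  apply: le_powR; rewrite ?(ltW p0)//.
    exact: mulr_ge0.
  rewrite /a (mulrA _ c) ler_wpM2r ?(ltW M0)//.
  apply: (@le_trans _ _ (L%:R^-1 * (2 / t * decay_weight m th N k.+1))).
    rewrite ler_wpM2l ?invr_ge0 ?(ltW L0')// ler_wpM2r ?(ltW w0)// ler_wpM2l//.
    by rewrite lef_pV2.
  rewrite le_eqVlt /t; apply/orP; left; apply/eqP; field.
  by rewrite !gt_eqF ?ltr0n.
(* Two-term Minkowski, for the Riemann sum and its error. *)
pose E e := \sum_j cube_partial j (f j) e - \sum_k F k e.
pose G (b : bool) e := if b then E e else \sum_k F k e.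
pose d (b : bool) := if b then (B + 1) / L%:R else P * M.
have d0 b : 0 < d b.
  by case: b; rewrite /= ?divr_gt0 ?ltr_wpDl// mulr_gt0.
have dsum : 0 < \sum_b d b by rewrite big_bool addr_gt0.
have Gd b : iid_avg (@coin R) (fun e : cube n => `|G b e| `^ p) <= d b `^ p.
  case: b => /=.
    rewrite -[leRHS](iid_avg_cst 'I_n _ (coin_sum R)).
    apply: iid_avg_le => [b|e]; first exact: coin_ge0.
    rewrite le_powR ?(ltW p0)//; apply: le_trans (HB L L0 e) _.
    by rewrite ler_wpM2r ?invr_ge0 ?(ltW L0')// lerDl.
  apply: le_trans (minkowski_iid a0 asum Fa) _.
  by rewrite le_powR ?(ltW p0) ?(ltW asum).
have := minkowski_iid d0 dsum Gd.
rewrite big_bool /= [X in _ <= X `^ _]addrC.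
have -> : iid_avg (@coin R) (fun e : cube n => `|\sum_b G b e| `^ p) =
   iid_avg (@coin R) (fun e : cube n => `|\sum_j cube_partial j (f j) e| `^ p).
  by apply: eq_iid_avg => // e; rewrite big_bool /= /E subrK.
set Z := iid_avg _ _ => HZ.
have Q0 : 0 <= P * M + (B + 1) / L%:R.
  exact: ltW (addr_gt0 (d0 false) (d0 true)).
rewrite -[leRHS](powRrKM pn0 Q0); apply: le_powR => //.
  by rewrite invr_ge0 ltW.
apply: sumr_ge0 => e _; rewrite mulr_ge0 ?powR_ge0 ?iid_weight_ge0//.
by move=> b; exact: coin_ge0.
Qed.

Lemma pisier_ineq :
  iid_avg (@coin R) (fun e : cube n => `|\sum_j cube_partial j (f j) e| `^ p) `^ p^-1 <=
  2 * (m%:R / (1 - th)) * rad_laplacian `^ p^-1.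
Proof.
case/andP: th01 => th0 th1.
have m0 : 0 < m%:R :> R by rewrite ltr0n ltnW.
have [B B0 H] := pisier_ineq_approx.
set P := 2 * _ in H *.
have P0 : 0 < P by rewrite mulr_gt0// divr_gt0// subr_gt0.
apply/ler_addgt0Pr => eta eta0.
(* Since [m ^ N] exceeds [N], the errors from [B] and from [eps] are each at most [eta / 2]. *)
set N := Num.bound (2 * B / eta).
have bN : 2 * B / eta < N%:R by apply: archi_boundP; rewrite divr_ge0 ?mulr_ge0// ltW.
have NmN : N%:R <= (m ^ N)%:R :> R by rewrite ler_nat ltnW// ltn_expl.
have mN0 : 0 < (m ^ N)%:R :> R by rewrite ltr0n expn_gt0 ltnW.
have eps0 : 0 < eta / (2 * P) by rewrite divr_gt0// mulr_gt0.
apply: le_trans (H N _ eps0) _; rewrite mulrDr -addrA lerD2l.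
have -> : P * (eta / (2 * P)) = eta / 2 by field; rewrite gt_eqF.
suff : B / (m ^ N)%:R <= eta / 2 by lra.
rewrite ler_pdivrMr//.
have : 2 * B / eta <= (m ^ N)%:R by apply: le_trans NmN; exact: ltW.
by rewrite ler_pdivrMr//; lra.
Qed.

End CubeInequality.

(** * Uniformity in the dimension *)

Theorem mainTheorem5 (R : realType) (X : banachLatticeType R) (p : R)
    (hX : nontrivial_type X) (hp : 1 < p) :
  (ereal_sup [set pisier_const X p n | n in [set: nat]] < +oo)%E.
Proof.
have p0 : 0 < p by exact: lt_trans hp.
have [k [c [k0 /andP[c0 c1]] Hc]] := nontrivial_type_rad_lower hp hX.
set m := #|cube k| in Hc.
have m1 : (1 < m)%N by rewrite /m card_ffun card_bool card_ord -{1}(expn0 2) ltn_exp2l.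
(* [c] is a gain for [p]-th moments; the weights in the Riemann sum act after the [p]-th root. *)
pose th := c `^ p^-1.
have th01 : 0 < th < 1.
  rewrite powR_gt0//= (_ : 1 = 1 `^ p^-1); last by rewrite powR1.
  by apply: gt0_ltr_powR; rewrite ?invr_gt0 ?nnegrE// ltW.
have thp : th `^ p = c by rewrite powRrMK ?gt_eqF ?ltW.
(* Determined by [p], [k] and [c], hence independent of [n]. *)
pose P := 2 * (m%:R / (1 - th)).
apply: (@le_lt_trans _ _ P%:E); last exact: ltry.
apply: ge_ereal_sup => _ [n _ <-]; apply: ereal_inf_lbound; exists P => //; split.
  case/andP: th01 => _ th1.
  by rewrite mulr_gt0// divr_gt0 ?subr_gt0// ltr0n ltnW.
move=> f; rewrite cube_avgE.
have -> : cube_avg (fun d : cube n => cube_avg (fun e : cube n =>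
    `|\sum_(j < n) sgn R d j *: cube_laplacian (f j) e| `^ p)) = rad_laplacian p f.
  rewrite cube_avgE /rad_laplacian [RHS]iid_avgC.
  by apply: eq_iid_avg => // d; rewrite cube_avgE.
apply: (pisier_ineq hp f m1 th01) => x; rewrite thp.
(* The colours are the [2 ^ k] vertices of [cube k], to which [Hc] applies. *)
by apply: sel_colour => //; exact: ltnW.
Qed.
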